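(* Let $J=(\sqrt{-3}-1)/2$ and let $\mathbf c=(c_0,c_1,c_2,\dots)$ be the sequence of complex numbers defined by $\prod_{k\ge 0}(1+Jx^{3^k})=\sum_{n\ge 0}c_nx^n$ (equivalently, $c_0=1$ and $c_{3n}=c_n$, $c_{3n+1}=Jc_n$, $c_{3n+2}=0$ for all $n\ge 0$). For $n\ge 1$, $p\ge 0$ let $H_n^p=(c_{p+i+j-2})_{1\le i,j\le n}$ be the $n\times n$ Hankel matrix of $\mathbf c$ starting at index $p$, and let $|H_n^p|$ be its determinant, with the convention $|H_0^p|=1$. Then for all $n\ge 0$: $$|H_0^0|=1,\quad |H_1^0|=1,\quad |H_{3n}^0|=|H_n^0|,\quad |H_{3n+1}^0|=|H_{n+1}^0|,\quad |H_{3n+2}^0|=-J^2|H_{n+1}^0|,$$ and $$|H_0^1|=1,\quad |H_{3n}^1|=|H_n^1|,\quad |H_{3n+1}^1|=J|H_n^1|,\quad |H_{3n+2}^1|=J|H_{n+1}^1|.$$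
   Context: For a sequence $\mathbf u=(u_k)_{k\ge0}$ of complex numbers, the $(p,n)$-order Hankel matrix is $H_n^p(\mathbf u)=(u_{p+i+j-2})_{1\le i,j\le n}$, i.e. the matrix with first row $u_p,u_{p+1},\dots,u_{p+n-1}$ and last row $u_{p+n-1},\dots,u_{p+2n-2}$; its determinant is denoted $|H_n^p(\mathbf u)|$, and by convention $|H_0^p(\mathbf u)|=1$. Note $J$ is a primitive cube root of unity. *)

(* Defs.v *)
From mathcomp Require Import all_boot all_order all_algebra.
From mathcomp Require Import reals.
From mathcomp Require Import complex.

Set Implicit Arguments.
Unset Strict Implicit.
Unset Printing Implicit Defensive.

Import GRing.Theory Num.Theory.
Local Open Scope ring_scope.

(* [sqrtC (-3)] is the square root of -3 with positive imaginary part, so [J]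
   is exp(2 i pi / 3). *)
Definition J (R : realType) : R[i] := (sqrtC (-3) - 1) / 2.

(* The identity prod_(k >= 0) f k = sum_(n >= 0) (c n) x^n of formal power
   series: each coefficient of the finite partial products is eventually equal
   to the corresponding coefficient of the series. *)
Definition formal_prod_eq (K : nzRingType) (f : nat -> {poly K})
    (c : nat -> K) : Prop :=
  forall n : nat, exists M : nat, forall m : nat, (M <= m)%N ->
    (\prod_(k < m) f k)`_n = c n.

(* Indices start at 0, whence u_(p + i + j) in place of u_(p + i + j - 2).
   For n = 0 the determinant is that of the empty matrix, which is 1. *)
Definition hankel (K : Type) (n p : nat) (u : nat -> K) : 'M[K]_n :=
  \matrix_(i < n, j < n) u (p + i + j)%N.

Lemma formal_prod_eq_unique (K : nzRingType) (f : nat -> {poly K})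
    (c d : nat -> K) :
  formal_prod_eq f c -> formal_prod_eq f d -> c =1 d.
Proof.
move=> fc fd n; have [M1 H1] := fc n; have [M2 H2] := fd n.
by rewrite -(H1 (maxn M1 M2)) ?leq_maxl// (H2 (maxn M1 M2)) ?leq_maxr.
Qed.

Lemma formal_prod_eq_exists (R : realType) :
  exists c : nat -> R[i],
    formal_prod_eq (fun k => 1 + (J R)%:P * 'X^(3 ^ k)) c.
Proof.
exists (fun n => (\prod_(k < n) (1 + (J R)%:P * 'X^(3 ^ k)))`_n) => n.
exists n => m /subnKC <-; elim: (m - n)%N => [|d IHd]; first by rewrite addn0.
rewrite addnS big_ord_recr /= mulrDr mulr1 coefD {}IHd mulrA coefMXn.
by rewrite (leq_ltn_trans (leq_addr d n) (ltn_expl _ _)) // addr0.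
Qed.

Lemma det_hankel0 (K : comNzRingType) (p : nat) (u : nat -> K) :
  \det (hankel 0 p u) = 1.
Proof. exact: det_mx00. Qed.

(* Main.v *)
(** Write [w] for [J] and let [A], [B] be Hankel matrices of [c] starting at 0
and 1.  Sorting rows and columns by their residue modulo 3 turns a Hankel matrix
of [c] into a 3 x 3 block matrix whose blocks are multiples of [A] and [B];
block elimination with [1 + w + w^2 = 0] splits its determinant into a smaller
Hankel determinant and a factor [det [[x A, B], [B, y B]]] with [x y = -1].
That factor reduces to [det B * det (A + B)] or to a product of a Hankel
determinant of [c] and one of [c_(k+1) + c_(k+2)], according to whether the two
diagonal blocks have equal sizes.  The recurrences therefore close up once
[s_k = c_k + c_(k+1)] is treated along with [c], and induction on [n] gives
  det H_n^1(c) * det H_n^0(s) = (-1)^n = det H_(n+1)^0(c) * det H_n^1(s). *)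

Require Import Defs.
From mathcomp Require Import all_boot all_order all_algebra.
From mathcomp Require Import reals.
From mathcomp Require Import complex.
From mathcomp Require Import fingroup perm zify ring.

Set Implicit Arguments.
Unset Strict Implicit.
Unset Printing Implicit Defensive.

Import GRing.Theory Num.Theory.
Local Open Scope ring_scope.

(** An injective [g] permutes the indices, and rows and columns undergo the same permutation, so the
    two signs cancel. Keeping [m] and [n] apart lets a sum of block sizes stand for the order of the
    matrix. *)
Lemma det_reindex (K : comNzRingType) (m n : nat) (F : nat -> nat -> K)
    (g : nat -> nat) :
  m = n -> (forall i, (i < m)%N -> (g i < n)%N) ->
  (forall i j, (i < m)%N -> (j < m)%N -> g i = g j -> i = j) ->
  \det (\matrix_(i < m, j < m) F (g i) (g j)) =
  \det (\matrix_(i < n, j < n) F i j).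
Proof.
move=> mn; subst m => g_lt g_inj.
pose f (i : 'I_n) := Ordinal (g_lt i (ltn_ord i)).
have f_inj : injective f.
  by move=> i j [/g_inj ij]; apply/val_inj/ij; apply: ltn_ord.
set A := \matrix_(i < n, j < n) F i j.
have -> : \matrix_(i < n, j < n) F (g i) (g j) =
    row_perm (perm f_inj) (col_perm (perm f_inj) A).
  by apply/matrixP => i j; rewrite !mxE !permE.
rewrite row_permE col_permE !det_mulmx !det_perm odd_permV mulrCA.
by rewrite -signr_addb addbb mulr1.
Qed.

(** * Rectangular Hankel matrices and block elimination *)

Section RectangularHankel.

Variable K : comNzRingType.
Implicit Types (u : nat -> K) (m n k p : nat).

Definition rhankel m n u : 'M[K]_(m, n) := \matrix_(i, j) u (i + j)%N.

Lemma eq_rhankel m n u v : u =1 v -> rhankel m n u = rhankel m n v.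
Proof. by move=> uv; apply/matrixP => i j; rewrite !mxE. Qed.

Lemma rhankelZ m n (x : K) u :
  rhankel m n (fun k => x * u k) = x *: rhankel m n u.
Proof. by apply/matrixP => i j; rewrite !mxE. Qed.

Lemma rhankelD m n u v :
  rhankel m n (fun k => u k + v k) = rhankel m n u + rhankel m n v.
Proof. by apply/matrixP => i j; rewrite !mxE. Qed.

Lemma rhankel0 m n : rhankel m n (fun=> 0) = 0.
Proof. by apply/matrixP => i j; rewrite !mxE. Qed.

Lemma hankelE n p u : hankel n p u = rhankel n n (fun k => u (p + k)%N).
Proof. by apply/matrixP => i j; rewrite !mxE addnA. Qed.

(** Left multiplication selects the rows from [p] to [p + m - 1]. On a Hankel matrix this shifts the
    sequence by [p], so eliminating between blocks of different heights yields Hankel matrices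
    again. *)
Definition shift_mx p m k : 'M[K]_(m, k) := \matrix_(i, j) (p + i == j)%N%:R.

Lemma mul_shift_rhankel p m k n u : (p + m <= k)%N ->
  shift_mx p m k *m rhankel k n u = rhankel m n (fun i => u (p + i)%N).
Proof.
move=> le_k; apply/matrixP => i j; rewrite !mxE.
have lt_i : (p + i < k)%N by have := ltn_ord i; lia.
rewrite (bigD1 (Ordinal lt_i)) //= !mxE eqxx mul1r big1 ?addr0 ?addnA // => l.
rewrite -val_eqE /= => /negPf nl; rewrite !mxE eq_sym.
by rewrite nl mul0r.
Qed.

Lemma mul_trunc_rhankel m k n u : (m <= k)%N ->
  shift_mx 0 m k *m rhankel k n u = rhankel m n u.
Proof. exact: (@mul_shift_rhankel 0). Qed.

(** The multiplier [X] stands in for the inverse of [P] in a Schur complement, so [P] may be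
    singular. *)
Lemma det_block_lower m n (P : 'M[K]_m) U L (Q : 'M[K]_n) X :
  X *m P + L = 0 ->
  \det (block_mx P U L Q) = \det P * \det (X *m U + Q).
Proof.
move=> XP; have := det_mulmx (block_mx 1%:M 0 X 1%:M) (block_mx P U L Q).
rewrite mulmx_block !mul1mx !mul0mx !addr0 XP.
by rewrite det_ublock det_lblock !det1 !mul1r.
Qed.

Lemma det_block_upper m n (P : 'M[K]_m) U L (Q : 'M[K]_n) X :
  U + X *m Q = 0 ->
  \det (block_mx P U L Q) = \det (P + X *m L) * \det Q.
Proof.
move=> XQ; have := det_mulmx (block_mx 1%:M X 0 1%:M) (block_mx P U L Q).
rewrite mulmx_block !mul1mx !mul0mx !add0r XQ.
by rewrite det_ublock det_lblock !det1 !mul1r.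
Qed.

(** Each bound says that the last index of a class, such as [3 * (nr - 1) + r], is below [N]. The
    order of the residues is left free because the pivot class depends on the sequence. *)
Lemma det_rhankel_residues u (N r s t nr ns nt : nat) :
    N = (nr + (ns + nt))%N -> uniq [:: r; s; t] ->
    (r < 3)%N -> (s < 3)%N -> (t < 3)%N ->
    (3 * nr + r < N + 3)%N -> (3 * ns + s < N + 3)%N ->
    (3 * nt + t < N + 3)%N ->
  \det (rhankel N N u) =
  \det (block_mx (rhankel nr nr (fun k => u (3 * k + (r + r))%N))
    (row_mx (rhankel nr ns (fun k => u (3 * k + (r + s))%N))
            (rhankel nr nt (fun k => u (3 * k + (r + t))%N)))
    (col_mx (rhankel ns nr (fun k => u (3 * k + (r + s))%N))
            (rhankel nt nr (fun k => u (3 * k + (r + t))%N)))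
    (block_mx (rhankel ns ns (fun k => u (3 * k + (s + s))%N))
              (rhankel ns nt (fun k => u (3 * k + (s + t))%N))
              (rhankel nt ns (fun k => u (3 * k + (s + t))%N))
              (rhankel nt nt (fun k => u (3 * k + (t + t))%N)))).
Proof.
move=> NE; rewrite /= !inE => u_rst r3 s3 t3 ler les let_.
pose g i := if (i < nr)%N then (3 * i + r)%N else
  if (i < nr + ns)%N then (3 * (i - nr) + s)%N
  else (3 * (i - nr - ns) + t)%N.
rewrite -(@det_reindex _ _ _ (fun i j => u (i + j)%N) g (esym NE)); first last.
- by rewrite /g => i j; do ?case: ifP; lia.
- by rewrite /g => i; do ?case: ifP; lia.
congr (\det _); apply/matrixP => i j; rewrite mxE.
have gl (a : 'I_nr) : g (lshift (ns + nt) a) = (3 * a + r)%N.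
  by rewrite /g /= ltn_ord.
have gm (a : 'I_ns) : g (rshift nr (lshift nt a)) = (3 * a + s)%N.
  by rewrite /g /=; have := ltn_ord a; do ?case: ifP; lia.
have gr (a : 'I_nt) : g (rshift nr (rshift ns a)) = (3 * a + t)%N.
  by rewrite /g /=; have := ltn_ord a; do ?case: ifP; lia.
have [i' ->|i1 ->] := split_ordP i; last have [i' ->|i' ->] := split_ordP i1;
  (have [j' ->|j1 ->] := split_ordP j; last have [j' ->|j' ->] := split_ordP j1);
  rewrite ?gl ?gm ?gr ?(block_mxEul, block_mxEur, block_mxEdl, block_mxEdr);
  rewrite ?(row_mxEl, row_mxEr, col_mxEu, col_mxEd) !mxE; congr u; lia.
Qed.



(** * Determinants of the two-by-two block factor *)

Section PairBlocks.

Variables (x y : K) (xyN1 : x * y = -1).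

Definition pair_mx m n (u : nat -> K) : 'M[K]_(m + n) :=
  block_mx (x *: rhankel m m u) (rhankel m n (u \o succn))
           (rhankel n m (u \o succn)) (y *: rhankel n n (u \o succn)).

(** Adding [x] times the lower block row to the upper one clears the upper right block, as
    [x * y = -1], and leaves [x] times a sum of two Hankel matrices at the upper left. *)
Lemma det_pair_mx_square n u :
  \det (pair_mx n n u) = (-1) ^+ n *
    (\det (rhankel n n (u \o succn)) *
     \det (rhankel n n (fun k => u k + u k.+1))).
Proof.
rewrite (@det_block_upper _ _ _ _ _ _ x%:M).
  rewrite !mul_scalar_mx -scalerDr -rhankelD !detZ mulrACA -exprMn xyN1.
  by congr (_ * _); rewrite mulrC.
by rewrite mul_scalar_mx scalerA xyN1 scaleN1r subrr.
Qed.

(** The last [n] rows of the upper block carry the shifted sequence; scaled by [y], they cancel the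
    lower left block. The extra [x] is what remains of [x ^+ n.+1] against [y ^+ n]. *)
Lemma det_pair_mx_wide n u :
  \det (pair_mx n.+1 n u) = x * ((-1) ^+ n *
    (\det (rhankel n.+1 n.+1 u) *
     \det (rhankel n n (fun k => u k.+1 + u k.+2)))).
Proof.
rewrite (@det_block_lower _ _ _ _ _ _ (y *: shift_mx 1 n n.+1)).
  rewrite -scalemxAl mul_shift_rhankel ?add1n // -scalerDr addrC -rhankelD !detZ.
  by rewrite mulrACA exprS -[x * _ * _]mulrA -exprMn xyN1 -mulrA.
rewrite -scalemxAl -scalemxAr scalerA mulrC xyN1 scaleN1r.
by rewrite mul_shift_rhankel // addNr.
Qed.

End PairBlocks.

End RectangularHankel.

Section CubeRootSequence.

Variables (K : comNzRingType) (w : K) (c : nat -> K).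
Hypotheses (w2 : w ^+ 2 = - 1 - w) (c_0 : c 0 = 1).
Hypotheses (c3 : forall k, c (3 * k) = c k)
  (c3_1 : forall k, c (3 * k + 1) = w * c k)
  (c3_2 : forall k, c (3 * k + 2) = 0).

Let c' := c \o succn.
Let s k := c k + c k.+1.
Let s' k := c k.+1 + c k.+2.

Let c3_3 k : c (3 * k + 3) = c k.+1.
Proof. by rewrite -[RHS]c3; congr c; lia. Qed.
Let c3_4 k : c (3 * k + 4) = w * c k.+1.
Proof. by rewrite -c3_1; congr c; lia. Qed.
Let c3_5 k : c (3 * k + 5) = 0.
Proof. by rewrite -(c3_2 k.+1); congr c; lia. Qed.
Let c3_6 k : c (3 * k + 6) = c k.+2.
Proof. by rewrite -[RHS]c3; congr c; lia. Qed.

Let w3 : w * w ^+ 2 = 1. Proof. by rewrite w2; ring: w2. Qed.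
Let wN1 : w * - w ^+ 2 = -1. Proof. by rewrite mulrN w3. Qed.
Let w4 : w ^+ 2 * - w ^+ 2 = - w.
Proof. by rewrite mulrN {1}expr2 -mulrA w3 mulr1. Qed.
Let Nw1 : - w ^+ 2 * w = -1. Proof. by rewrite mulrC. Qed.

(** * Splitting the four Hankel determinants modulo 3 *)

Section Trisection.

(** The sizes [n0], [n1], [n2] count the indices below [N] congruent to 0, 1, 2 modulo 3. *)
Variables (N n0 n1 n2 : nat).
Hypotheses (NE : N = (n0 + (n1 + n2))%N)
  (le21 : (n2 <= n1)%N) (le10 : (n1 <= n0)%N) (le02 : (n0 <= n2.+1)%N).

(** Class 0 is the pivot: subtracting [w] times its rows from those of class 1 turns the zero
    diagonal block of class 1 into a multiple of [- w ^+ 2]. *)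
Lemma det_c : \det (rhankel N N c) =
  \det (rhankel n0 n0 c) * \det (pair_mx (- w ^+ 2) w n1 n2 c).
Proof.
rewrite (@det_rhankel_residues _ c N 0 1 2 n0 n1 n2); try by [|lia].
have E0 m n : rhankel m n (fun k => c (3 * k + (0 + 0))%N) = rhankel m n c.
  by apply: eq_rhankel => k; rewrite !addn0 c3.
have E1 m n : rhankel m n (fun k => c (3 * k + (0 + 1))%N) = w *: rhankel m n c.
  by rewrite -rhankelZ; apply: eq_rhankel => k; rewrite c3_1.
have E2 m n : rhankel m n (fun k => c (3 * k + (0 + 2))%N) = 0.
  by rewrite -(rhankel0 _ m n); apply: eq_rhankel => k; rewrite c3_2.
have E2' m n : rhankel m n (fun k => c (3 * k + (1 + 1))%N) = 0 := E2 m n.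
have E3 m n : rhankel m n (fun k => c (3 * k + (1 + 2))%N) = rhankel m n c'.
  by apply: eq_rhankel => k; rewrite c3_3.
have E4 m n : rhankel m n (fun k => c (3 * k + (2 + 2))%N) = w *: rhankel m n c'.
  by rewrite -rhankelZ; apply: eq_rhankel => k; rewrite c3_4.
rewrite !(E0, E1, E2, E2', E3, E4).
rewrite (@det_block_lower _ _ _ _ _ _ _ (col_mx (- w *: shift_mx K 0 n1 n0) 0)).
  congr (_ * \det _); rewrite mul_col_row add_block_mx !mul0mx !mulmx0 !add0r.
  rewrite addr0 -scalemxAl -scalemxAr scalerA mul_trunc_rhankel //.
  by rewrite mulNr -expr2.
rewrite mul_col_mx add_col_mx mul0mx addr0 -scalemxAl mul_trunc_rhankel //.
by rewrite scaleNr addNr col_mx0.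
Qed.

(** Class 1 is the pivot, orthogonal to class 0; it is used to clear its coupling with class 2. *)
Lemma det_c' : \det (rhankel N N c') =
  \det (rhankel n1 n1 c') * \det (pair_mx w (- w ^+ 2) n0 n2 c).
Proof.
rewrite (@det_rhankel_residues _ c' N 1 0 2 n1 n0 n2); try by [|lia].
have E0 m n : rhankel m n (fun k => c' (3 * k + (0 + 0))%N) = w *: rhankel m n c.
  by rewrite -rhankelZ; apply: eq_rhankel => k; rewrite /c' /= -addnS c3_1.
have E1 m n : rhankel m n (fun k => c' (3 * k + (1 + 0))%N) = 0.
  by rewrite -(rhankel0 _ m n); apply: eq_rhankel => k; rewrite /c' /= -addnS c3_2.
have E2 m n : rhankel m n (fun k => c' (3 * k + (0 + 2))%N) = rhankel m n c'.
  by apply: eq_rhankel => k; rewrite /c' /= -addnS c3_3.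
have E2' m n : rhankel m n (fun k => c' (3 * k + (1 + 1))%N) = rhankel m n c'.
  exact: E2.
have E3 m n : rhankel m n (fun k => c' (3 * k + (1 + 2))%N) = w *: rhankel m n c'.
  by rewrite -rhankelZ; apply: eq_rhankel => k; rewrite /c' /= -addnS c3_4.
have E4 m n : rhankel m n (fun k => c' (3 * k + (2 + 2))%N) = 0.
  by rewrite -(rhankel0 _ m n); apply: eq_rhankel => k; rewrite /c' /= -addnS c3_5.
rewrite !(E0, E1, E2, E2', E3, E4).
rewrite (@det_block_lower _ _ _ _ _ _ _ (col_mx 0 (- w *: shift_mx K 0 n2 n1))).
  congr (_ * \det _); rewrite mul_col_row add_block_mx !mul0mx !mulmx0 !add0r.
  rewrite addr0 -scalemxAl -scalemxAr scalerA mul_trunc_rhankel //.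
  by rewrite mulNr -expr2.
rewrite mul_col_mx add_col_mx mul0mx addr0 -scalemxAl mul_trunc_rhankel //.
by rewrite scaleNr addNr col_mx0.
Qed.

(** Classes 0 and 2 already form the pair block. Adding [w ^+ 2] times class 0 to class 1 clears
    both upper right blocks at once, and since [w ^+ 3 = 1] the pivot becomes the Hankel matrix of
    [s]. *)
Lemma det_s : \det (rhankel N N s) =
  \det (rhankel n1 n1 s) * \det (pair_mx (- w ^+ 2) w n0 n2 c).
Proof.
rewrite (@det_rhankel_residues _ s N 1 0 2 n1 n0 n2); try by [|lia].
have E0 m n : rhankel m n (fun k => s (3 * k + (0 + 0))%N) =
    - w ^+ 2 *: rhankel m n c.
  rewrite -rhankelZ; apply: eq_rhankel => k.
  by rewrite /s -addnS c3_1 !addn0 c3 w2; ring.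
have E1 m n : rhankel m n (fun k => s (3 * k + (1 + 0))%N) = w *: rhankel m n c.
  by rewrite -rhankelZ; apply: eq_rhankel => k; rewrite /s -addnS c3_1 c3_2 addr0.
have E2 m n : rhankel m n (fun k => s (3 * k + (0 + 2))%N) = rhankel m n c'.
  by apply: eq_rhankel => k; rewrite /s -addnS c3_2 c3_3 add0r.
have E2' m n : rhankel m n (fun k => s (3 * k + (1 + 1))%N) = rhankel m n c'.
  exact: E2.
have E3 m n : rhankel m n (fun k => s (3 * k + (1 + 2))%N) =
    - w ^+ 2 *: rhankel m n c'.
  rewrite -rhankelZ; apply: eq_rhankel => k.
  by rewrite /s -addnS c3_3 c3_4 w2 /c' /=; ring.
have E4 m n : rhankel m n (fun k => s (3 * k + (2 + 2))%N) = w *: rhankel m n c'.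
  by rewrite -rhankelZ; apply: eq_rhankel => k; rewrite /s -addnS c3_4 c3_5 addr0.
rewrite !(E0, E1, E2, E2', E3, E4).
rewrite (@det_block_upper _ _ _ _ _ _ _ (row_mx (w ^+ 2 *: shift_mx K 0 n1 n0) 0)).
  congr (\det _ * _); rewrite mul_row_col mul0mx addr0.
  rewrite -scalemxAl -scalemxAr scalerA mul_trunc_rhankel // mulrC w3 scale1r.
  by rewrite addrC -rhankelD.
rewrite mul_row_block add_row_mx !mul0mx !addr0 -!scalemxAl -!scalemxAr.
by rewrite !mul_trunc_rhankel // scalerA w4 !scaleNr addrN addNr row_mx0.
Qed.

(** The same mechanism with pivot class 2, to which [w ^+ 2] times class 1 is added. *)
Lemma det_s' : \det (rhankel N N s') =
  \det (rhankel n2 n2 s') * \det (pair_mx w (- w ^+ 2) n0 n1 c).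
Proof.
rewrite (@det_rhankel_residues _ s' N 2 0 1 n2 n0 n1); try by [|lia].
have E0 m n : rhankel m n (fun k => s' (3 * k + (0 + 0))%N) = w *: rhankel m n c.
  rewrite -rhankelZ; apply: eq_rhankel => k.
  by rewrite /s' -!addnS c3_1 c3_2 addr0.
have E1 m n : rhankel m n (fun k => s' (3 * k + (0 + 1))%N) = rhankel m n c'.
  by apply: eq_rhankel => k; rewrite /s' -!addnS c3_2 c3_3 add0r.
have E2 m n : rhankel m n (fun k => s' (3 * k + (2 + 0))%N) =
    - w ^+ 2 *: rhankel m n c'.
  rewrite -rhankelZ; apply: eq_rhankel => k.
  by rewrite /s' -!addnS c3_3 c3_4 w2 /c' /=; ring.
have E2' m n : rhankel m n (fun k => s' (3 * k + (1 + 1))%N) =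
    - w ^+ 2 *: rhankel m n c' := E2 m n.
have E3 m n : rhankel m n (fun k => s' (3 * k + (2 + 1))%N) = w *: rhankel m n c'.
  rewrite -rhankelZ; apply: eq_rhankel => k.
  by rewrite /s' -!addnS c3_4 c3_5 addr0.
have E4 m n : rhankel m n (fun k => s' (3 * k + (2 + 2))%N) =
    rhankel m n (c' \o succn).
  by apply: eq_rhankel => k; rewrite /s' -!addnS c3_5 c3_6 add0r.
rewrite !(E0, E1, E2, E2', E3, E4).
rewrite (@det_block_upper _ _ _ _ _ _ _ (row_mx 0 (w ^+ 2 *: shift_mx K 0 n2 n1))).
  congr (\det _ * _); rewrite mul_row_col mul0mx add0r.
  rewrite -scalemxAl -scalemxAr scalerA mul_trunc_rhankel // mulrC w3 scale1r.
  by rewrite addrC -rhankelD.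
rewrite mul_row_block add_row_mx !mul0mx !add0r -!scalemxAl -!scalemxAr.
by rewrite !mul_trunc_rhankel // scalerA w4 !scaleNr addrN addNr row_mx0.
Qed.

End Trisection.

(** * Recurrences modulo 3 and the sign invariants *)

Let a n := \det (rhankel n n c).
Let b n := \det (rhankel n n c').
Let e n := \det (rhankel n n s).
Let f n := \det (rhankel n n s').

Let inv_be n := b n * e n = (-1) ^+ n.
Let inv_af n := a n.+1 * f n = (-1) ^+ n.

(** The invariant supplies a second sign [(-1) ^+ n], which cancels the one produced by the
    elimination. *)
Let det_pair_square x y n : x * y = -1 -> inv_be n ->
  \det (pair_mx x y n n c) = 1.
Proof.
move=> xy be; rewrite (det_pair_mx_square xy) -[_ * \det _]/(b n * e n) be.
by rewrite -expr2 sqrr_sign.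
Qed.

Let det_pair_wide x y n : x * y = -1 -> inv_af n ->
  \det (pair_mx x y n.+1 n c) = x.
Proof.
move=> xy af; rewrite (det_pair_mx_wide xy) -[_ * \det _]/(a n.+1 * f n) af.
by rewrite -expr2 sqrr_sign mulr1.
Qed.

(** The recurrences are grouped by the invariant they consume. Here both diagonal blocks of the pair
    factor have size [n]. *)
Lemma det_rhankel_rec_be n : inv_be n ->
  [/\ a (3 * n) = a n, a (3 * n + 1) = a n.+1, b (3 * n) = b n,
      e (3 * n) = e n & f (3 * n) = f n].
Proof.
move=> be; split.
- by rewrite /a (@det_c _ n n n) ?det_pair_square ?mulr1 //; lia.
- by rewrite /a (@det_c _ n.+1 n n) ?det_pair_square ?mulr1 //; lia.
- by rewrite /b (@det_c' _ n n n) ?det_pair_square ?mulr1 //; lia.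
- by rewrite /e (@det_s _ n n n) ?det_pair_square ?mulr1 //; lia.
- by rewrite /f (@det_s' _ n n n) ?det_pair_square ?mulr1 //; lia.
Qed.

(** These are the cases with diagonal blocks of sizes [n.+1] and [n]. *)
Lemma det_rhankel_rec_af n : inv_af n ->
  [/\ a (3 * n + 2) = - w ^+ 2 * a n.+1,
      b (3 * n + 1) = w * b n /\ b (3 * n + 2) = w * b n.+1,
      e (3 * n + 1) = - w ^+ 2 * e n /\ e (3 * n + 2) = - w ^+ 2 * e n.+1
    & f (3 * n + 1) = w * f n].
Proof.
move=> af; split; [|split|split|].
- by rewrite /a (@det_c _ n.+1 n.+1 n) ?det_pair_wide // 1?mulrC //; lia.
- by rewrite /b (@det_c' _ n.+1 n n) ?det_pair_wide // 1?mulrC //; lia.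
- by rewrite /b (@det_c' _ n.+1 n.+1 n) ?det_pair_wide // 1?mulrC //; lia.
- by rewrite /e (@det_s _ n.+1 n n) ?det_pair_wide // 1?mulrC //; lia.
- by rewrite /e (@det_s _ n.+1 n.+1 n) ?det_pair_wide // 1?mulrC //; lia.
- by rewrite /f (@det_s' _ n.+1 n n) ?det_pair_wide // 1?mulrC //; lia.
Qed.

(** Both diagonal blocks have size [n.+1] here, whence the invariant at [n.+1]. *)
Lemma det_rhankel_rec_s' n : inv_be n.+1 -> f (3 * n + 2) = f n.
Proof.
move=> be; rewrite /f (@det_s' _ n.+1 n.+1 n) ?det_pair_square ?mulr1 //; lia.
Qed.

Lemma det_rhankel_invariants n : inv_be n /\ inv_af n.
Proof.
elim/ltn_ind: n => n IHn.
have [q [r r3 nE]] : exists q, exists2 r, (r < 3)%N & n = (3 * q + r)%N.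
  by exists (n %/ 3)%N, (n %% 3)%N; lia.
(* At 0 the quotient [q] is not smaller than [n], so this case is computed directly. *)
have [q0|q0] := posnP n.
  rewrite /inv_be /inv_af q0 /a /b /e /f !det_mx00 !mulr1; split=> //.
  by rewrite [rhankel _ _ _]mx11_scalar det_scalar1 mxE.
have sgn m : (-1) ^+ (3 * m) = (-1) ^+ m :> K.
  by rewrite -signr_odd oddM signr_odd.
have [beq afq] : inv_be q /\ inv_af q by apply: IHn; lia.
have [a3 a31 b3 e3 f3] := det_rhankel_rec_be beq.
have [a32 [b31 b32] [e31 e32] f31] := det_rhankel_rec_af afq.
case: r r3 nE => [|[|[|//]]] _ nE; rewrite /inv_be /inv_af nE -?addnS.
- by rewrite addn0 -addn1 a31 b3 e3 f3 sgn.
- rewrite b31 e31 a32 f31 [w * _ * _]mulrACA [_ * _ * (w * _)]mulrACA wN1 Nw1.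
  by rewrite beq afq exprD sgn mulrC.
(* The next index [3 * q + 3] starts a new period, so the invariant at [q.+1] is required; [q.+1] is
   still below [3 * q + 2]. *)
- have [beq1 _] : inv_be q.+1 /\ inv_af q.+1 by apply: IHn; lia.
  have [a33 _ _ _ _] := det_rhankel_rec_be beq1.
  rewrite b32 e32 mulrACA wN1 beq1 (det_rhankel_rec_s' beq1).
  have -> : (3 * q + 3 = 3 * q.+1)%N by lia.
  by rewrite a33 afq exprD sgn sqrrN expr1n mulr1 exprS !mulN1r opprK.
Qed.

Lemma det_rhankel_rec n :
  [/\ a (3 * n) = a n, a (3 * n + 1) = a (n + 1)
    & a (3 * n + 2) = - w ^+ 2 * a (n + 1)] /\
  [/\ b (3 * n) = b n, b (3 * n + 1) = w * b n
    & b (3 * n + 2) = w * b (n + 1)].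
Proof.
have [beq afq] := det_rhankel_invariants n.
have [? ? ? _ _] := det_rhankel_rec_be beq.
have [? [? ?] _ _] := det_rhankel_rec_af afq.
by rewrite [(n + 1)%N]addn1.
Qed.

End CubeRootSequence.

(** * From the infinite product to the ternary recurrences *)

Lemma J_sqr (R : realType) : J R ^+ 2 = - 1 - J R.
Proof.
have: sqrtC (- 3 : R[i]) ^+ 2 = - 3 by rewrite sqrtCK.
by rewrite /J; set r := sqrtC _ => r2; field: r2.
Qed.

(** Splitting off the factor [k = 0] gives P_(m+1)(x) = (1 + w x) P_m(x^3) for the partial products;
    the recurrences follow by comparing coefficients. *)
Lemma formal_prod_ternary (K : comNzRingType) (w : K) (c : nat -> K) :
  formal_prod_eq (fun k => 1 + w%:P * 'X^(3 ^ k)) c ->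
  [/\ c 0 = 1, forall k, c (3 * k)%N = c k,
      forall k, c (3 * k + 1)%N = w * c k
    & forall k, c (3 * k + 2)%N = 0].
Proof.
move=> hc; set P := fun m => \prod_(k < m) (1 + w%:P * 'X^(3 ^ k)).
have PS m : P m.+1 = (1 + w *: 'X) * (P m \Po 'X^3).
  rewrite /P big_ord_recl expn0 expr1 mul_polyC; congr (_ * _).
  rewrite rmorph_prod; apply: eq_bigr => k _ /=.
  rewrite rmorphD rmorph1 rmorphM /= comp_polyC.
  by rewrite rmorphXn /= comp_polyX -exprM -expnS.
(* One [m] past both stabilization thresholds serves the two consecutive partial products. *)
have cP n k : exists m, (P m.+1)`_n = c n /\ (P m)`_k = c k.
  have [M1 H1] := hc n; have [M2 H2] := hc k.
  by exists (maxn M1 M2); rewrite H1 ?H2 //; lia.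
(* The test [n == 0] matters: [0.-1] is 0, which is divisible by 3. *)
have PSn m n : (P m.+1)`_n = (if (3 %| n)%N then (P m)`_(n %/ 3) else 0) +
    w * (if n == 0 then 0
         else if (3 %| n.-1)%N then (P m)`_(n.-1 %/ 3) else 0).
  rewrite PS mulrDl mul1r coefD -scalerAl coefZ coefXM.
  by rewrite !coef_comp_poly_Xn.
split.
- have [M HM] := hc 0; rewrite -(HM M (leqnn _)) -/(P M).
  elim: (M) => [|m IHm]; first by rewrite /P big_ord0 coef1.
  by rewrite PSn /= div0n IHm mulr0 addr0.
- move=> k; have [m [<- <-]] := cP (3 * k)%N k.
  rewrite PSn dvdn_mulr // mulKn //; case: eqP => k0; first by rewrite mulr0 addr0.
  by rewrite ifN ?mulr0 ?addr0 //; lia.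
- move=> k; have [m [<- <-]] := cP (3 * k + 1)%N k.
  rewrite PSn ifN; last by lia.
  by rewrite addn1 /= dvdn_mulr // mulKn // add0r.
- move=> k; have [m [<- _]] := cP (3 * k + 2)%N 0.
  by rewrite PSn ifN; [rewrite addn2 /= ifN ?mulr0 ?addr0 //; lia | lia].
Qed.

Theorem theorem1p1 (R : realType) (c : nat -> R[i])
    (hc : formal_prod_eq (fun k : nat => 1 + (J R)%:P * 'X^(3 ^ k)) c) :
  forall n : nat,
    [/\ \det (hankel 0 0 c) = 1,
        \det (hankel 1 0 c) = 1,
        \det (hankel (3 * n) 0 c) = \det (hankel n 0 c),
        \det (hankel (3 * n + 1) 0 c) = \det (hankel (n + 1) 0 c)
      & \det (hankel (3 * n + 2) 0 c)
          = - J R ^+ 2 * \det (hankel (n + 1) 0 c)]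
    /\
    [/\ \det (hankel 0 1 c) = 1,
        \det (hankel (3 * n) 1 c) = \det (hankel n 1 c),
        \det (hankel (3 * n + 1) 1 c) = J R * \det (hankel n 1 c)
      & \det (hankel (3 * n + 2) 1 c) = J R * \det (hankel (n + 1) 1 c)].
Proof.
move=> n; rewrite !hankelE.
have [c_0 c3 c3_1 c3_2] := formal_prod_ternary hc.
have [[a3 a31 a32] [b3 b31 b32]] := det_rhankel_rec (J_sqr R) c_0 c3 c3_1 c3_2 n.
split; split=> //; try exact: det_mx00.
by rewrite [rhankel _ _ _]mx11_scalar det_scalar1 mxE.
Qed.
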